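(* Let $(X,m)$ be a $\sigma$-finite measure space and let $Q$ with domain $\mathcal D$ and $Q^\#$ with domain $\mathcal D^\#$ be Dirichlet forms on $L^2(X,m)$ such that $\mathcal D\subseteq\mathcal D^\#$ and $Q^\#=Q$ on $\mathcal D\times\mathcal D$, with generators $L$ and $L^\#$. Assume the maximum principle: $(L+1)^{-1}f\le(L^\#+1)^{-1}f$ $m$-a.e. for all $0\le f\in L^2(X,m)$. Then the following are equivalent: (i) $\mathcal D\neq\mathcal D^\#$; (ii) there exists a nontrivial $u\in L^1(X,m)\cap D(L')$ with $u\ge0$, $L'u\le0$ and $L'u\neq0$. If these assertions hold, then the function $u$ in (ii) can be chosen in $L^1(X,m)\cap L^\infty(X,m)$, and such a function satisfies $\int_X L'u\,dm\neq0$.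
   Context: A Dirichlet form on $L^2(X,m)$ is a densely defined, nonnegative, closed, symmetric bilinear form satisfying the contraction property; its generator is the nonnegative self-adjoint operator $L$ with $Q(u,v)=\langle Lu,v\rangle$ for $u\in D(L)$, $v\in D(Q)$. $\langle\cdot,\cdot\rangle$ is the $L^2(X,m)$ inner product. The operator $L'$ has domain $D(L')=\{u\in\mathcal D^\#\mid \exists w\in L^2(X,m)\text{ with } Q^\#(u,v)=\langle w,v\rangle\text{ for all }v\in\mathcal D\}$ and acts by $L'u=w$. *)

(* Defs.v *)
From HB Require Import structures.
From mathcomp Require Import all_boot all_order all_algebra.
From mathcomp Require Import all_classical all_reals all_analysis.

Set Implicit Arguments.
Unset Strict Implicit.
Unset Printing Implicit Defensive.

Import Order.TTheory GRing.Theory Num.Theory.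
Local Open Scope classical_set_scope.
Local Open Scope ring_scope.

(* Elements of L^2(X,m) are represented by (measurable, square-integrable)
   functions X -> R; all notions below are invariant under m-a.e. equality. *)
Section Dirichlet.
Context {d : measure_display} {X : measurableType d} {R : realType}
  (m : {measure set X -> \bar R}).

Definition L2fun (f : X -> R) : Prop :=
  measurable_fun setT f /\ (\int[m]_x ((f x) ^+ 2)%:E < +oo)%E.

Definition inner (f g : X -> R) : R := Rintegral m setT (fun x => f x * g x).

Definition aeeq (f g : X -> R) : Prop := {ae m, forall x, f x = g x}.
Definition aele (f g : X -> R) : Prop := {ae m, forall x, f x <= g x}.

Definition form_norm2 (Q : (X -> R) -> (X -> R) -> R) (u : X -> R) : R :=
  Q u u + inner u u.

Definition is_dirichlet_form (D : set (X -> R)) (Q : (X -> R) -> (X -> R) -> R)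
  : Prop :=
  D `<=` L2fun /\
  (forall u v, D u -> L2fun v -> aeeq u v -> D v) /\
  (forall u u' v v', D u -> D u' -> D v -> D v' -> aeeq u u' -> aeeq v v' ->
     Q u v = Q u' v') /\
  D (fun=> 0) /\
  (forall (a : R) u v, D u -> D v -> D (fun x => a * u x + v x)) /\
  (forall (a : R) u v w, D u -> D v -> D w ->
     Q (fun x => a * u x + v x) w = a * Q u w + Q v w) /\
  (forall u v, D u -> D v -> Q u v = Q v u) /\
  (forall u, D u -> 0 <= Q u u) /\
  (forall f, L2fun f -> forall e : R, 0 < e ->
     exists u, D u /\ inner (fun x => u x - f x) (fun x => u x - f x) < e) /\
  (forall u : nat -> X -> R, (forall n, D (u n)) ->
     (forall e : R, 0 < e -> exists N, forall n k, (N <= n)%N -> (N <= k)%N ->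
        form_norm2 Q (fun x => u n x - u k x) < e) ->
     exists v, D v /\ (forall e : R, 0 < e -> exists N, forall n, (N <= n)%N ->
        form_norm2 Q (fun x => u n x - v x) < e)) /\
  (forall u, D u ->
     D (fun x => Num.min (Num.max (u x) 0) 1) /\
     Q (fun x => Num.min (Num.max (u x) 0) 1)
       (fun x => Num.min (Num.max (u x) 0) 1) <= Q u u).

(* graph of the generator L of (D,Q): u \in D(L) and L u = w (up to a.e.) *)
Definition is_gen (D : set (X -> R)) (Q : (X -> R) -> (X -> R) -> R)
  (u w : X -> R) : Prop :=
  D u /\ L2fun w /\ (forall v, D v -> Q u v = inner w v).

Definition resolvent (D : set (X -> R)) (Q : (X -> R) -> (X -> R) -> R)
  (f u : X -> R) : Prop :=
  exists w, is_gen D Q u w /\ aeeq (fun x => w x + u x) f.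

Definition is_Lprime (D Ds : set (X -> R)) (Qs : (X -> R) -> (X -> R) -> R)
  (u w : X -> R) : Prop :=
  Ds u /\ L2fun w /\ (forall v, D v -> Qs u v = inner w v).

Definition ess_bounded (u : X -> R) : Prop :=
  exists C : R, {ae m, forall x, `|u x| <= C}.

Definition cond_ii (D Ds : set (X -> R)) (Qs : (X -> R) -> (X -> R) -> R)
  (u w : X -> R) : Prop :=
  m.-integrable setT (fun x => (u x)%:E) /\
  is_Lprime D Ds Qs u w /\
  ~ aeeq u (fun=> 0) /\
  aele (fun=> 0) u /\
  aele w (fun=> 0) /\
  ~ aeeq w (fun=> 0).

End Dirichlet.

(* Main.v *)
Require Import Defs.
From HB Require Import structures.
From mathcomp Require Import all_boot all_order all_algebra.
From mathcomp Require Import all_classical all_reals all_analysis.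
From mathcomp Require Import measurable_realfun.
From mathcomp Require Import ring lra.
Import Order.TTheory GRing.Theory Num.Theory.
Local Open Scope classical_set_scope.
Local Open Scope ring_scope.

(* If D = Ds, then Q(u,u) = <L'u,u> <= 0 forces Q(u,.) = 0 by Cauchy-Schwarz, so
   L'u = 0 by density.  If D <> Ds, the two resolvents differ at some integrable f
   with 0 <= f <= 1, and u = (Ls+1)^-1 f - (L+1)^-1 f satisfies L'u = -u; it is
   nonnegative by the maximum principle, bounded by the Markov property and
   integrable because the symmetric Markovian resolvents map such an f to L^1. *)

(** * Positive semidefinite forms on a domain: Cauchy-Schwarz and Riesz representation *)

Section PsdForm.
Set Implicit Arguments.
Unset Strict Implicit.
Context {R : realType} {V : lmodType R}.
Implicit Types (D : set V) (B : V -> V -> R).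

(** Common interface for [Q], [Qs], [inner m] and the energy forms [Q + inner m]. With
    [V := X -> R^o], [a *: u + v] is the pointwise combination used in [is_dirichlet_form]. *)
Record psd_form D B : Prop := PsdForm {
  psd_comb : forall (a : R) u v, D u -> D v -> D (a *: u + v);
  psd_lin : forall (a : R) u v w, D u -> D v -> D w ->
    B (a *: u + v) w = a * B u w + B v w;
  psd_sym : forall u v, D u -> D v -> B u v = B v u;
  psd_ge0 : forall u, D u -> 0 <= B u u }.

Lemma psd_comb_sq D B a u v : psd_form D B -> D u -> D v ->
  B (a *: u + v) (a *: u + v) = a ^+ 2 * B u u + 2 * a * B u v + B v v.
Proof.
move=> h Du Dv; have Dw := psd_comb h a Du Dv.
rewrite (psd_lin h) // (psd_sym h (u := u)) // (psd_sym h (u := v)) //.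
rewrite !(psd_lin h) // (psd_sym h Dv Du) //; ring.
Qed.

Lemma psd_sub D B u v : psd_form D B -> D u -> D v ->
  D (u - v) /\ B (u - v) (u - v) = B u u - 2 * B u v + B v v.
Proof.
move=> h Du Dv; have -> : u - v = (- 1) *: v + u by rewrite scaleN1r addrC.
split; first exact: (psd_comb h).
by rewrite (psd_comb_sq _ h) // (psd_sym h Dv Du) //; ring.
Qed.

Lemma psd_subl D B u v w : psd_form D B -> D u -> D v -> D w ->
  B (u - v) w = B u w - B v w.
Proof.
move=> h Du Dv Dw; have -> : u - v = (- 1) *: v + u by rewrite scaleN1r addrC.
rewrite (psd_lin h) //; ring.
Qed.

(** For [a > 0] evaluate at the vertex [- b / a]; for [a = 0], possible since the forms may be
    degenerate, an affine function of nonzero slope would take the value [-1]. *)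
Lemma discriminant_le (a b c : R) : 0 <= a ->
  (forall t, 0 <= t ^+ 2 * a + 2 * t * b + c) -> b ^+ 2 <= a * c.
Proof.
rewrite le_eqVlt => /predU1P[<-|a0] H.
  have [->|b0] := eqVneq b 0; first by rewrite expr0n mul0r.
  have := H (- (c + 1) / (2 * b)).
  have -> : (- (c + 1) / (2 * b)) ^+ 2 * 0 + 2 * (- (c + 1) / (2 * b)) * b + c = - 1.
    by field.
  lra.
have := H (- b / a).
have -> : (- b / a) ^+ 2 * a + 2 * (- b / a) * b + c = (a * c - b ^+ 2) / a.
  by field; rewrite gt_eqF.
by rewrite pmulr_lge0 ?invr_gt0 // subr_ge0.
Qed.

Lemma psd_cauchy_schwarz D B u v : psd_form D B -> D u -> D v ->
  B u v ^+ 2 <= B u u * B v v.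
Proof.
move=> h Du Dv; apply: discriminant_le => [|t]; first exact: (psd_ge0 h).
rewrite -(psd_comb_sq t h Du Dv).
exact: (psd_ge0 h (psd_comb h t Du Dv)).
Qed.

(* The minimizer of B v v - 2 l v represents l; a minimizing sequence is
   Cauchy by the parallelogram identity. *)
Lemma psd_riesz D B (l : V -> R) (C : R) : psd_form D B -> D 0 ->
  (forall u : nat -> V, (forall n, D (u n)) ->
     (forall e : R, 0 < e -> exists N, forall n k, (N <= n)%N -> (N <= k)%N ->
        B (u n - u k) (u n - u k) < e) ->
     exists v, D v /\ (forall e : R, 0 < e -> exists N, forall n, (N <= n)%N ->
        B (u n - v) (u n - v) < e)) ->
  (forall (a : R) u v, D u -> D v -> l (a *: u + v) = a * l u + l v) ->
  0 <= C -> (forall v, D v -> l v ^+ 2 <= C * B v v) ->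
  exists u, D u /\ forall v, D v -> B u v = l v.
Proof.
move=> h D0 complB llin C0 lC.
pose J v := B v v - 2 * l v.
have J_ge v : D v -> - C <= J v.
  move=> Dv; have := lC _ Dv; have := psd_ge0 h Dv; rewrite /J.
  move: (B v v) (l v) => b x b0 xb; rewrite leNgt; apply/negP => xbC.
  (* Impossible: [2 * x > b + C >= 0] would give [4 * x ^+ 2 > (b + C) ^+ 2 >= 4 * C * b]. *)
  have : 0 < (2 * x - (b + C)) * (2 * x + (b + C)) by rewrite mulr_gt0 //; lra.
  by have := sqr_ge0 (b - C); nra.
pose S := [set J v | v in D].
have S_inf : has_inf S.
  by split; [exists (J 0); exists 0|exists (- C) => _ [v Dv <-]; exact: J_ge].
have J_inf v : D v -> inf S <= J v.
  by move=> Dv; apply: ge_inf; [case: S_inf|exists v].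
have /choice[u uP] n : exists v, D v /\ J v < inf S + n.+1%:R^-1.
  have [|_ [v Dv <-] Jv] := @inf_adherent _ S n.+1%:R^-1 _ S_inf.
    by rewrite invr_gt0.
  by exists v.
have Du n : D (u n) by have [] := uP n.
have J_u n : J (u n) < inf S + n.+1%:R^-1 by have [] := uP n.
have J_comb t v w : D v -> D w ->
    J (t *: v + w) = t ^+ 2 * B v v + 2 * t * (B v w - l v) + J w.
  by move=> Dv Dw; rewrite /J (psd_comb_sq _ h) // llin //; ring.
have inv_small (e : R) : 0 < e -> exists N, forall n, (N <= n)%N -> n.+1%:R^-1 < e.
  move=> e0; have [N _ NP] := near_infty_natSinv_lt (PosNum e0).
  by exists N => n Nn; exact: NP.
have [|v [Dv uv]] := complB u Du.
  move=> e e0; have [|N NP] := inv_small (e / 4); first by rewrite divr_gt0.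
  exists N => n k /NP en /NP ek.
  have [Dd _] := psd_sub h (Du n) (Du k).
  (* At the midpoint, [J] is the mean of [J (u n)] and [J (u k)] minus a quarter of
     [B (u n - u k) (u n - u k)], and it is at least [inf S]. *)
  have := J_comb 1 _ _ Dd (Du k); rewrite scale1r subrK.
  have := J_inf _ (psd_comb h 2^-1 Dd (Du k)); rewrite J_comb //.
  have := J_u n; have := J_u k; move: en ek.
  move: (B (u n - u k) (u n - u k)) (B _ _ - l _) => b p.
  move: (J (u n)) (J (u k)) (inf S) (n.+1%:R^-1) (k.+1%:R^-1) => Jn Jk I n1 k1.
  lra.
exists v; split => // w Dw; apply/eqP; rewrite -subr_eq0 -sqrf_eq0.
rewrite eq_le sqr_ge0 andbT; apply/ler_addgt0Pl => e e0; rewrite addr0.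
have Bw := psd_ge0 h Dw.
(* [B v w - l w] splits into two terms whose squares are each at most [B w w] times this tolerance;
   the square of a sum costs a factor 2, and [+ 1] covers [B w w = 0]. *)
have e'0 : 0 < e / (4 * (B w w + 1)) by rewrite divr_gt0 // mulr_gt0 // ltr_wpDl.
have [N1 N1P] := inv_small _ e'0; have [N2 N2P] := uv _ e'0.
have := N1P (maxn N1 N2) (leq_maxl _ _); have := N2P (maxn N1 N2) (leq_maxr _ _).
set n := maxn N1 N2.
have [Ddv _] := psd_sub h (Du n) Dv.
have := psd_cauchy_schwarz h Ddv Dw; rewrite (psd_subl h) //.
(* An almost minimizer is almost stationary: [inf S <= J (t *: w + u n)] for all [t] bounds a
   discriminant. *)
have : (B w (u n) - l w) ^+ 2 <= B w w * n.+1%:R^-1.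
  apply: discriminant_le => // t.
  have := J_inf _ (psd_comb h t Dw (Du n)); rewrite J_comb //.
  have := J_u n; move: (J (u n)) (inf S) (B w w) (B _ _ - _) (n.+1%:R^-1) => Jn I b p q.
  by move: (t ^+ 2 * b) (2 * t * p) => tb tp; lra.
rewrite (psd_sym h Dw (Du n)).
move: (B _ _) (B w w) Bw (B (u n - v) _) (B (u n) w) (l w) (n.+1%:R^-1) e'0 => x b b0 y z q k.
set e' := e / _ => e'0 h1 h2 h3 h4.
have ee : e = 4 * (b + 1) * e' by rewrite /e'; field; lra.
have : b * k <= b * e' by rewrite ler_wpM2l // ltW.
have : y * b <= e' * b by rewrite ler_wpM2r // ltW.
have : 0 <= (z - q + (z - x)) ^+ 2 by exact: sqr_ge0.
rewrite ee; nra.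
Qed.

End PsdForm.

(** * Square-integrable functions and a separating class of test functions *)

Section L2.
Set Implicit Arguments.
Unset Strict Implicit.
Context {d : measure_display} {X : measurableType d} {R : realType}
  (m : {measure set X -> \bar R}).
Implicit Types f g u v : X -> R.

Local Notation integrableR f := (m.-integrable setT (EFin \o f)).

Lemma le_integrableR f g : measurable_fun setT f ->
  (forall x, `|f x| <= g x) -> integrableR g -> integrableR f.
Proof.
move=> mf fg; apply: le_integrable => //; first exact/measurable_EFinP.
by move=> x _ /=; rewrite lee_fin (le_trans (fg x)) // ler_norm.
Qed.

Lemma L2fun_sq_integrable f : L2fun m f -> integrableR (fun x => f x ^+ 2).
Proof.
move=> [mf ff]; apply/integrableP; split.
  by apply/measurable_EFinP; exact: measurable_funX.
under eq_integral => x _ do rewrite /= ger0_norm ?sqr_ge0 //.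
exact: ff.
Qed.

Lemma sq_integrable_L2fun f : measurable_fun setT f ->
  integrableR (fun x => f x ^+ 2) -> L2fun m f.
Proof.
move=> mf /integrableP[_ ff]; split => //.
by under eq_integral => x _ do rewrite -[_ ^+ 2]ger0_norm ?sqr_ge0 //.
Qed.

Lemma integrableR_comb a f g : integrableR f -> integrableR g ->
  integrableR (fun x => a * f x + g x).
Proof. by move=> hf hg; exact: (integrableD _ (integrableZl _ a hf) hg). Qed.

Lemma L2fun_mul_integrable f g : L2fun m f -> L2fun m g ->
  integrableR (fun x => f x * g x).
Proof.
move=> hf hg.
apply: (@le_integrableR _ (fun x => 1 * f x ^+ 2 + g x ^+ 2)).
- by apply: measurable_funM; [case: hf|case: hg].
- move=> x; rewrite mul1r normrM -(real_normK (num_real (f x))) -(real_normK (num_real (g x))).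
  have := sqr_ge0 (`|f x| - `|g x|); have := normr_ge0 (f x); have := normr_ge0 (g x).
  nra.
- by apply: integrableR_comb; exact: L2fun_sq_integrable.
Qed.

Lemma L2fun_comb a f g : L2fun m f -> L2fun m g -> L2fun m (fun x => a * f x + g x).
Proof.
move=> hf hg.
have mh : measurable_fun setT (fun x => a * f x + g x).
  by apply: measurable_funD; [apply: measurable_funM; [exact: measurable_cst|case: hf]|case: hg].
apply: sq_integrable_L2fun => //.
apply: (@le_integrableR _ (fun x => (2 * a ^+ 2) * f x ^+ 2 + (1 * g x ^+ 2 + g x ^+ 2))).
- exact: measurable_funX.
- move=> x; rewrite ger0_norm ?sqr_ge0 //.
  by have := sqr_ge0 (a * f x - g x); nra.
- by do 2 (apply: integrableR_comb; first exact: L2fun_sq_integrable);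
    exact: L2fun_sq_integrable.
Qed.

Lemma L2funZ a f : L2fun m f -> L2fun m (fun x => a * f x).
Proof.
move=> hf; have := L2fun_comb (a - 1) hf hf; congr (L2fun m _).
by apply/funext => x; ring.
Qed.

Lemma le_L2fun f g : measurable_fun setT f -> (forall x, `|f x| <= `|g x|) ->
  L2fun m g -> L2fun m f.
Proof.
move=> mf fg hg; apply: sq_integrable_L2fun => //.
apply: (@le_integrableR _ (fun x => g x ^+ 2)).
- exact: measurable_funX.
- by move=> x; rewrite normrX -[leRHS]real_normK ?num_real // lerXn2r ?nnegrE.
- exact: L2fun_sq_integrable.
Qed.

Lemma innerC f g : inner m f g = inner m g f.
Proof. by apply: eq_Rintegral => x _; rewrite mulrC. Qed.

Lemma inner_aeeq f g h : L2fun m f -> L2fun m g -> L2fun m h -> aeeq m f g ->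
  inner m f h = inner m g h.
Proof.
move=> hf hg hh fg; rewrite /inner /Rintegral; congr fine.
apply: ae_eq_integral => //.
- by have /integrableP[] := L2fun_mul_integrable hf hh.
- by have /integrableP[] := L2fun_mul_integrable hg hh.
- by move: fg; apply: filterS => x /= <- _.
Qed.

Lemma innerZr a f g : L2fun m f -> L2fun m g ->
  inner m f (fun x => a * g x) = a * inner m f g.
Proof.
move=> hf hg; rewrite /inner -RintegralZl //; last exact: L2fun_mul_integrable.
by apply: eq_Rintegral => x _; rewrite mulrCA.
Qed.

Lemma psd_inner : psd_form (V := X -> R^o) (L2fun m) (inner m).
Proof.
split.
- by move=> a u v; exact: L2fun_comb.
- move=> a u v w hu hv hw; rewrite /inner.
  rewrite -RintegralZl //; last exact: L2fun_mul_integrable.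
  rewrite -RintegralD //; first last.
  + exact: L2fun_mul_integrable.
  + exact: (integrableZl _ a (L2fun_mul_integrable hu hw)).
  + by apply: eq_Rintegral => x _; rewrite mulrDl mulrA.
- by move=> u v _ _; exact: innerC.
- by move=> u _; apply: Rintegral_ge0 => x _; rewrite -expr2 sqr_ge0.
Qed.

Lemma Rintegral_eq0_ae f : integrableR f -> (forall x, 0 <= f x) ->
  Rintegral m setT f = 0 -> aeeq m f (fun=> 0).
Proof.
move=> hf f0 I0.
have /integrableP[mf _] := hf.
have : (\int[m]_x `|(f x)%:E| = 0)%E.
  under eq_integral => x _ do rewrite gee0_abs ?lee_fin //.
  by rewrite -[LHS]fineK ?integrable_fin_num // -/(Rintegral _ _ _) I0.
move/(ae_eq_integral_abs m measurableT mf).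
by apply: filterS => x /(_ I) /= [].
Qed.

Lemma inner_self_eq0 f : L2fun m f -> inner m f f = 0 -> aeeq m f (fun=> 0).
Proof.
move=> hf; move/Rintegral_eq0_ae => H.
have : aeeq m (fun x => f x * f x) (fun=> 0).
  by apply: H; [exact: L2fun_mul_integrable|move=> x; rewrite -expr2 sqr_ge0].
by apply: filterS => x /eqP; rewrite mulf_eq0 orbb => /eqP.
Qed.

(** Values in [[0, 1]] bound the resolvent by the Markov property and integrability puts it in L^1,
    yet the class still separates L^2. *)
Definition test_fun f : Prop :=
  [/\ measurable_fun setT f, forall x, 0 <= f x <= 1 & integrableR f].

Lemma test_fun_L2 f : test_fun f -> L2fun m f.
Proof.
move=> [mf f01 hf]; apply: sq_integrable_L2fun => //.
apply: le_integrableR hf; first exact: measurable_funX.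
move=> x; rewrite ger0_norm ?sqr_ge0 //; have := f01 x; nra.
Qed.

(** The square is what makes the majorant [c * g ^+ 2] integrable for [g] in L^2. *)
Lemma test_fun_trunc c g : 0 <= c -> L2fun m g ->
  test_fun (fun x => Num.min 1 (c * g x ^+ 2)).
Proof.
move=> c0 hg.
have mh : measurable_fun setT (fun x => Num.min 1 (c * g x ^+ 2)).
  apply: measurable_minr => //; apply: measurable_funM => //.
  by apply: measurable_funX; case: hg.
have h0 x : 0 <= c * g x ^+ 2 by rewrite mulr_ge0 ?sqr_ge0.
split => //.
  by move=> x; rewrite le_min ler01 h0 /= ge_min lexx.
apply: (@le_integrableR _ (fun x => c * g x ^+ 2)) => //.
  move=> x; rewrite ger0_norm ?ge_min ?lexx ?orbT //.
  by rewrite le_min ler01 h0.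
exact: (integrableZl _ c (L2fun_sq_integrable hg)).
Qed.

(** Test against the square of the positive part of [g], cut at 1: the product with [g] is
    nonnegative with integral 0, hence null, while the test function is positive where [g] is. *)
Lemma test_fun_le0 g : L2fun m g -> (forall f, test_fun f -> inner m f g = 0) ->
  aele m g (fun=> 0).
Proof.
move=> hg H; have mg : measurable_fun setT g by case: hg.
have hp : L2fun m (fun x => Num.max (g x) 0).
  apply: le_L2fun hg; first exact: measurable_maxr.
  by move=> x; case: (leP 0 (g x)) => // _; rewrite normr0 normr_ge0.
have hf := test_fun_trunc ler01 hp.
have := Rintegral_eq0_ae (L2fun_mul_integrable (test_fun_L2 hf) hg) _ (H _ hf).
move=> /= K; have {K} : aeeq m (fun x => Num.min 1 (1 * Num.max (g x) 0 ^+ 2) * g x) (fun=> 0).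
  apply: K => x; case: (leP 0 (g x)) => g0.
    by rewrite mulr_ge0 // le_min ler01 mul1r sqr_ge0.
  by rewrite expr0n /= mulr0 min_r // mul0r.
apply: filterS => x; rewrite mul1r; case: (leP 0 (g x)) => g0; last by rewrite ltW.
move/eqP; rewrite mulf_eq0 => /orP[|/eqP -> //].
by case: (leP 1 (g x ^+ 2)) => _; rewrite ?oner_eq0 // sqrf_eq0 => /eqP ->.
Qed.

Lemma test_fun_separating g : L2fun m g ->
  (forall f, test_fun f -> inner m f g = 0) -> aeeq m g (fun=> 0).
Proof.
move=> hg H; have gle0 := test_fun_le0 hg H.
have gge0 : aele m (fun x => -1 * g x) (fun=> 0).
  apply: test_fun_le0 => [|f hf]; first exact: L2funZ.
  by rewrite innerZr ?H ?mulr0 //; exact: test_fun_L2.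
move: gle0 gge0; apply: filterS2 => x g1 g2.
by apply/eqP; rewrite eq_le g1 /=; lra.
Qed.

End L2.

(** * Resolvents of a Dirichlet form at test functions *)

Section Resolvent.
Set Implicit Arguments.
Unset Strict Implicit.
Context {d : measure_display} {X : measurableType d} {R : realType}
  (m : {measure set X -> \bar R}).
Implicit Types f g u v : X -> R.

Local Notation integrableR f := (m.-integrable setT (EFin \o f)).

(* min(1, n u^2) increases to the indicator of u <> 0. *)
Lemma test_fun_bounded_integrable (C : R) u : L2fun m u -> (forall x, 0 <= u x) ->
  (forall f, test_fun m f -> inner m f u <= C) -> integrableR u.
Proof.
move=> hu u0 H; have mu : measurable_fun setT u by case: hu.
pose h n x := Num.min 1 (n%:R * u x ^+ 2).
have hh n : test_fun m (h n) by exact: test_fun_trunc.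
have h0 n x : 0 <= h n x by have [_ /(_ x) /andP[]] := hh n.
apply/integrableP; split; first exact/measurable_EFinP.
have -> : (\int[m]_x `|(EFin \o u) x| = \int[m]_x (u x)%:E)%E.
  by apply: eq_integral => x _; rewrite gee0_abs ?lee_fin.
have mh n : measurable_fun setT (fun x => h n x * u x).
  by apply: measurable_funM => //; case: (hh n).
have lim_u x : limn (fun n => (h n x * u x)%:E) = (u x)%:E.
  apply: cvg_lim => //; apply: cvg_near_cst.
  have [ux|ux] := eqVneq (u x) 0; first by apply: nearW => n; rewrite ux mulr0.
  have ux0 : 0 < u x ^+ 2 by rewrite exprn_gt0 // lt_neqAle eq_sym ux /=.
  near=> n; rewrite /h min_l ?mul1r //.
  rewrite -ler_pdivrMr // div1r.
  by near: n; exact: nbhs_infty_ger.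
under eq_integral => x _ do rewrite -lim_u.
rewrite monotone_convergence //; last 3 first.
- by move=> n; exact/measurable_EFinP.
- by move=> n x _; rewrite lee_fin mulr_ge0.
- move=> x _ n k nk; rewrite lee_fin ler_wpM2r // /h le_min !ge_min lexx /=.
  by rewrite ler_wpM2r ?orbT ?sqr_ge0 // ler_nat.
apply: (@le_lt_trans _ _ C%:E); last exact: ltry.
apply: lime_le.
  apply: ereal_nondecreasing_is_cvgn => n k nk; apply: ge0_le_integral => //.
  - by move=> x _; rewrite lee_fin mulr_ge0.
  - exact/measurable_EFinP.
  - exact/measurable_EFinP.
  - move=> x _; rewrite lee_fin ler_wpM2r // /h le_min !ge_min lexx /=.
    by rewrite ler_wpM2r ?orbT ?sqr_ge0 // ler_nat.
apply: nearW => n; have := H _ (hh n).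
rewrite -lee_fin fineK //.
exact: (integrable_fin_num _ (L2fun_mul_integrable (test_fun_L2 (hh n)) hu)).
Unshelve. all: by end_near. Qed.

Section Form.
Variables (D : set (X -> R)) (Q : (X -> R) -> (X -> R) -> R).
Hypothesis hQ : is_dirichlet_form m D Q.

Lemma form_L2 u : D u -> L2fun m u.
Proof. by case: hQ => H _; exact: H. Qed.

Lemma psd_dirichlet : psd_form (V := X -> R^o) D Q.
Proof.
have [_ [_ [_ [_ [hD [hlin [hsym [hpos _]]]]]]]] := hQ.
by split.
Qed.

(** The energy form, with square norm [form_norm2]: closedness of [Q] is its completeness, so Riesz
    representation applies to it. *)
Lemma psd_form1 : psd_form (V := X -> R^o) D (fun u v => Q u v + inner m u v).
Proof.
have hq := psd_dirichlet; have hi := psd_inner m.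
split; first exact: (psd_comb hq).
- move=> a u v w hu hv hw; rewrite (psd_lin hq) // (psd_lin hi); try exact: form_L2.
  by rewrite mulrDr addrACA.
- by move=> u v hu hv; rewrite (psd_sym hq) // innerC.
- by move=> u hu; rewrite addr_ge0 ?(psd_ge0 hq) ?(psd_ge0 hi) //; exact: form_L2.
Qed.

Lemma form_riesz (l : (X -> R) -> R) (C : R) :
  (forall (a : R) u v, D u -> D v -> l (fun x => a * u x + v x) = a * l u + l v) ->
  0 <= C -> (forall v, D v -> l v ^+ 2 <= C * form_norm2 m Q v) ->
  exists u, D u /\ forall v, D v -> Q u v + inner m u v = l v.
Proof.
move=> llin C0 lC.
have [_ [_ [_ [hD0 [_ [_ [_ [_ [_ [hc _]]]]]]]]]] := hQ.
exact: (psd_riesz psd_form1 hD0 hc llin C0 lC).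
Qed.

(** The equation [(L + 1) u = f] in variational form, solvable by Riesz; the value of [L u] is
    recovered as [f - u]. *)
Definition weak_resolvent f u : Prop :=
  D u /\ forall v, D v -> Q u v + inner m u v = inner m f v.

Lemma weak_resolventP f u : L2fun m f -> weak_resolvent f u -> resolvent m D Q f u.
Proof.
move=> hf [Du hu]; have hi := psd_inner m; have u2 := form_L2 Du.
exists (fun x => f x - u x); split; last by apply: aeW => x; rewrite subrK.
split => //; split; first by have [] := psd_sub hi hf u2.
move=> v Dv; rewrite [RHS](psd_subl hi hf u2 (form_L2 Dv)).
by rewrite -hu // addrK.
Qed.

(* The truncation of u does not increase the functional
   v |-> Q v v + inner v v - 2 inner f v, of which u is the unique minimizer. *)
Lemma resolvent_markov f u : test_fun m f -> weak_resolvent f u ->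
  aeeq m u (fun x => Num.min (Num.max (u x) 0) 1).
Proof.
move=> hf [Du hu]; have [_ [_ [_ [_ [_ [_ [_ [_ [_ [_ hT]]]]]]]]]] := hQ.
have [Dv Qv] := hT u Du; set v := (fun x => _) in Dv Qv *.
have [Dw] := psd_sub psd_form1 Du Dv.
have hf2 := test_fun_L2 hf.
have [[u2 v2] w2] := (form_L2 Du, form_L2 Dv, form_L2 Dw).
(* Pointwise, projecting [u x] onto [[0, 1]] does not increase its distance to [f x], itself in
   [[0, 1]]; the common term [f x ^+ 2] is left out. *)
have hle : inner m v v - 2 * inner m f v <= inner m u u - 2 * inner m f u.
  have aux z : L2fun m z -> integrableR (fun x => z x ^+ 2 + (-2) * (f x * z x)) /\
     Rintegral m setT (fun x => z x ^+ 2 + (-2) * (f x * z x)) =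
     inner m z z - 2 * inner m f z.
    move=> hz; have i1 := L2fun_sq_integrable hz.
    have i2 := integrableZl measurableT (-2) (L2fun_mul_integrable hf2 hz).
    split; first exact: (integrableD _ i1 i2).
    by rewrite RintegralD // RintegralZl ?mulNr //; exact: L2fun_mul_integrable.
  have [iv <-] := aux v v2; have [iu <-] := aux u u2.
  apply: le_Rintegral => // x _; have [_ /(_ x) f01 _] := hf.
  rewrite /v; case: (leP 0 (u x)) => u0; last by rewrite min_l //; nra.
  by case: (leP (u x) 1) => u1 //; nra.
have Qw := psd_ge0 psd_dirichlet Dw; have Iw := psd_ge0 (psd_inner m) w2.
(* By the equation for [u], the energy of [u - v] is the functional at [v] minus that at [u], which
   is at most 0 by [Qv] and [hle]. *)
rewrite (hu u Du) (hu v Dv) => hw.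
have : inner m (u - v : X -> R) (u - v : X -> R) = 0.
  apply/eqP; rewrite eq_le Iw andbT; move: hw hle Qv Qw (hu u Du).
  lra.
move/(inner_self_eq0 w2); apply: filterS => x.
by move=> /eqP; rewrite subr_eq0 => /eqP.
Qed.

(** Riesz represents [inner m f] in the energy form; replacing the solution by its a.e. equal
    truncation makes the bounds hold at every point. *)
Lemma test_resolvent f : test_fun m f -> exists u,
  weak_resolvent f u /\ forall x, 0 <= u x <= 1.
Proof.
move=> hf; have hf2 := test_fun_L2 hf.
have [|||u [Du hu]] := @form_riesz (inner m f) (inner m f f).
- move=> a u v Du Dv; rewrite innerC.
  rewrite [LHS](psd_lin (psd_inner m) a (form_L2 Du) (form_L2 Dv) hf2).
  by rewrite ![inner m _ f]innerC.
- exact: (psd_ge0 (psd_inner m)).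
- move=> v Dv; have v2 := form_L2 Dv.
  apply: le_trans (psd_cauchy_schwarz (psd_inner m) hf2 v2) _.
  rewrite ler_wpM2l ?(psd_ge0 (psd_inner m)) // lerDr.
  exact: (psd_ge0 psd_dirichlet).
have uT := resolvent_markov hf (conj Du hu).
have [_ [_ [hae [_ [_ [_ [_ [_ [_ [_ hT]]]]]]]]]] := hQ.
exists (fun x => Num.min (Num.max (u x) 0) 1); split; last first.
  by move=> x; rewrite le_min ge_min le_max !lexx ler01 !orbT.
have [Dv _] := hT u Du; split => // w Dw.
have ww : aeeq m w w by apply: aeW.
rewrite -(hae _ _ _ _ Du Dv Dw Dw uT ww) -hu //; congr (_ + _).
by rewrite -(inner_aeeq _ _ _ uT) //; exact: form_L2.
Qed.

(** Both sides are the energy product of [u] and [v]. *)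
Lemma weak_resolvent_sym f g u v : L2fun m f -> L2fun m g ->
  weak_resolvent f u -> weak_resolvent g v -> inner m f v = inner m g u.
Proof.
move=> hf hg [Du hu] [Dv hv]; rewrite -hu // -hv //.
exact: (psd_sym psd_form1).
Qed.

(** Duality: for a test function [g] with resolvent [v <= 1], symmetry gives [<g, u> = <f, v>], at
    most the integral of [f]. *)
Lemma test_resolvent_integrable f u : test_fun m f -> weak_resolvent f u ->
  (forall x, 0 <= u x) -> integrableR u.
Proof.
move=> hf hu u0; have hf2 := test_fun_L2 hf.
apply: (@test_fun_bounded_integrable (Rintegral m setT f)) => //.
  by case: hu => /form_L2.
move=> g hg; have hg2 := test_fun_L2 hg; have [v [hv v01]] := test_resolvent hg.
rewrite -(weak_resolvent_sym hf2 hg2 hu hv).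
have [_ f01 fi] := hf.
apply: le_Rintegral => //.
  by apply: L2fun_mul_integrable => //; case: hv => /form_L2.
by move=> x _; have := f01 x; have := v01 x; nra.
Qed.

End Form.

End Resolvent.

(** * Integrals of a.e. nonpositive functions *)

Section AeSign.
Context {d : measure_display} {X : measurableType d} {R : realType}
  (m : {measure set X -> \bar R}).
Implicit Types f : X -> R.

(** Minus the integral of an everywhere nonnegative function shows both sign and vanishing, even
    when the value is [-oo]. *)
Lemma ae_le0_integral f : measurable_fun setT f -> aele m f (fun=> 0) ->
  (\int[m]_x (f x)%:E = - \int[m]_x `|(Num.min (f x) 0)%:E|)%E.
Proof.
move=> mf f0; have mg : measurable_fun setT (fun x => Num.min (f x) 0).
  exact: measurable_minr.
rewrite -integral_ge0N //.
apply: ae_eq_integral => //; first exact/measurable_EFinP.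
- by apply: measurableT_comp => //; apply: measurableT_comp => //; exact/measurable_EFinP.
- move: f0; apply: filterS => x f0 _ /=.
  by rewrite min_l // ler0_norm // opprK.
Qed.

Lemma ae_le0_Rintegral f : measurable_fun setT f -> aele m f (fun=> 0) ->
  Rintegral m setT f <= 0.
Proof.
move=> mf f0; rewrite /Rintegral ae_le0_integral // fineN oppr_le0.
(* An infinite integral is sent to 0 by [fine], which keeps the inequality. *)
by apply: fine_ge0; exact: integral_ge0.
Qed.

Lemma ae_le0_integral_neq0 f : measurable_fun setT f -> aele m f (fun=> 0) ->
  ~ aeeq m f (fun=> 0) -> (\int[m]_x (f x)%:E != 0)%E.
Proof.
move=> mf f0 fn0; rewrite ae_le0_integral // oppe_eq0; apply/eqP => I0.
have mg : measurable_fun setT (EFin \o (fun x => Num.min (f x) 0)).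
  by apply/measurable_EFinP; exact: measurable_minr.
apply: fn0; have := (ae_eq_integral_abs m measurableT mg).1 I0.
by move: f0; apply: filterS2 => x f0 /(_ I) /=; rewrite min_l // => -[].
Qed.

End AeSign.

Section Extension.
Set Implicit Arguments.
Unset Strict Implicit.
Context {d : measure_display} {X : measurableType d} {R : realType}
  (m : {measure set X -> \bar R}).
Variables (D Ds : set (X -> R)) (Q Qs : (X -> R) -> (X -> R) -> R).
Hypotheses (hQ : is_dirichlet_form m D Q) (hQs : is_dirichlet_form m Ds Qs).
Hypotheses (hsub : D `<=` Ds).
Hypothesis (hagree : forall u v, D u -> D v -> Qs u v = Q u v).

(** Orthogonality turns the squared distance from [w] to [v] in [D] into the sum of their squared
    norms, so density makes the norm of [w] arbitrarily small. *)
Lemma inner_dense_eq0 w : L2fun m w -> (forall v, D v -> inner m w v = 0) ->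
  aeeq m w (fun=> 0).
Proof.
move=> hw H; have hi := psd_inner m; apply: inner_self_eq0 => //.
apply/eqP; rewrite eq_le (psd_ge0 hi) // andbT; apply/ler_addgt0Pl => e e0.
have [_ [_ [_ [_ [_ [_ [_ [_ [hdense _]]]]]]]]] := hQ.
have [v [Dv]] := hdense w hw e e0; have v2 := form_L2 hQ Dv.
have [_ E] := psd_sub hi v2 hw.
rewrite [X in X < _]E innerC H // => hlt.
have := psd_ge0 hi v2; move: hlt; lra.
Qed.

(* The Qs_1-orthogonal projection v of u to D satisfies <f, u - v> = 0 for every
   test function f, because both resolvents agree at f. *)
Lemma resolvents_eq_domain :
  (forall f u us, test_fun m f -> weak_resolvent m D Q f u ->
    weak_resolvent m Ds Qs f us -> (forall x, 0 <= u x <= 1) ->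
    (forall x, 0 <= us x <= 1) -> aeeq m u us) ->
  Ds `<=` D.
Proof.
move=> hres u Du; have hp := psd_form1 hQs.
(* The energy product with [u], restricted to [D], is bounded by Cauchy-Schwarz in [Ds]; its
   representative in [D] is the projection. *)
have [|||v [Dv hv]] := @form_riesz _ _ _ _ _ _ hQ
    (fun v => Qs u v + inner m u v) (Qs u u + inner m u u).
- move=> a v w Dv Dw; have [Dv' Dw'] := (hsub Dv, hsub Dw).
  have Dc := psd_comb hp a Dv' Dw'.
  rewrite [LHS](psd_sym hp Du Dc) (psd_lin hp a Dv' Dw' Du).
  by rewrite (psd_sym hp Dv' Du) (psd_sym hp Dw' Du).
- exact: (psd_ge0 hp).
- move=> v Dv; rewrite /form_norm2 -hagree //.
  exact: (psd_cauchy_schwarz hp Du (hsub Dv)).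
have Dv' := hsub Dv.
have [Dw _] := psd_sub hp Du Dv'.
have w2 := form_L2 hQs Dw.
suff : aeeq m (u - v : X -> R) (fun=> 0).
  move=> uv; have [_ [hD _]] := hQ; apply: (hD v) => //.
    exact: (form_L2 hQs Du).
  by move: uv; apply: filterS => x /eqP; rewrite subr_eq0 => /eqP.
apply: test_fun_separating => // f hf.
have [g [[Dg hg] g01]] := test_resolvent hQ hf.
have [gs [[Dgs hgs] gs01]] := test_resolvent hQs hf.
have ggs := hres f g gs hf (conj Dg hg) (conj Dgs hgs) g01 gs01.
have [_ [_ [hae _]]] := hQs; have Dg' := hsub Dg.
have ww : aeeq m (u - v : X -> R) (u - v : X -> R) by apply: aeW.
(* [<f, u - v>] is the energy product of [gs] with [u - v]; here [gs] may be replaced by [g], which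
   lies in [D], to which [u - v] is orthogonal. *)
rewrite -hgs // -(hae _ _ _ _ Dg' Dgs Dw Dw ggs ww).
rewrite -(inner_aeeq (form_L2 hQ Dg) (form_L2 hQs Dgs) w2 ggs).
rewrite [LHS](psd_sym hp Dg' Dw) (psd_subl hp Du Dv' Dg').
by rewrite (hagree Dv Dg) hv // subrr.
Qed.

Lemma Lprime_nonpos_domain_neq u w : cond_ii m D Ds Qs u w -> D <> Ds.
Proof.
move=> [_ [[Dsu [w2 hw]] [_ [u0 [w0 wn0]]]]] DE.
have Du : D u by rewrite DE.
apply: wn0; apply: inner_dense_eq0 => // v Dv; rewrite -hw //.
have hq := psd_dirichlet hQs.
(* Once [D = Ds], [u] is itself an admissible test vector for [hw]. *)
have Quu : Qs u u = 0.
  apply/eqP; rewrite eq_le (psd_ge0 hq) // andbT hw //.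
  apply: ae_le0_Rintegral.
    by apply: measurable_funM; [case: w2|case: (form_L2 hQs Dsu)].
  by move: u0 w0; apply: filterS2 => x u0 w0; rewrite mulr_le0_ge0.
apply/eqP; rewrite -sqrf_eq0 eq_le sqr_ge0 andbT.
have := psd_cauchy_schwarz hq Dsu (hsub Dv); by rewrite Quu mul0r.
Qed.

Hypothesis hmax : forall f u us, L2fun m f -> aele m (fun=> 0) f ->
  resolvent m D Q f u -> resolvent m Ds Qs f us -> aele m u us.

Lemma domain_neq_Lprime_nonpos : D <> Ds ->
  exists u w, cond_ii m D Ds Qs u w /\ ess_bounded m u.
Proof.
move=> DDs.
(* Otherwise the resolvents would agree at all test functions, forcing equal domains. *)
have [f [g [gs [hf [Rg Rgs] [g01 gs01] gn]]]] : exists f g gs,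
    [/\ test_fun m f, weak_resolvent m D Q f g /\ weak_resolvent m Ds Qs f gs,
      (forall x, 0 <= g x <= 1) /\ (forall x, 0 <= gs x <= 1) & ~ aeeq m g gs].
  apply: contrapT => H; apply: DDs; apply/seteqP; split => //.
  apply: resolvents_eq_domain => f g gs hf Rg Rgs g01 gs01.
  by apply: contrapT => gn; apply: H; exists f, g, gs.
have hf2 := test_fun_L2 hf; have [_ f01 _] := hf.
have f0 : aele m (fun=> 0) f by apply: aeW => x; have /andP[] := f01 x.
have ggs := hmax hf2 f0 (weak_resolventP hQ hf2 Rg) (weak_resolventP hQs hf2 Rgs).
have [[Dg hg] [Dgs hgs]] := (Rg, Rgs); have Dsg := hsub Dg.
have ig := test_resolvent_integrable hQ hf Rg (fun x => proj1 (andP (g01 x))).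
have igs := test_resolvent_integrable hQs hf Rgs (fun x => proj1 (andP (gs01 x))).
have hqs := psd_dirichlet hQs; have hi := psd_inner m.
have [Du _] := psd_sub hqs Dgs Dsg; have [g2 gs2] := (form_L2 hQ Dg, form_L2 hQs Dgs).
(* Subtracting the two resolvent equations, tested on [D], cancels [f] and leaves
   [Qs (gs - g) v = <g - gs, v>]. *)
exists (fun x => gs x - g x), (fun x => g x - gs x); split; first split.
- exact: (integrableB _ igs ig).
- split; first split => //.
    split; first by have [] := psd_sub hi g2 gs2.
    move=> v Dv; have Dsv := hsub Dv; have v2 := form_L2 hQ Dv.
    rewrite [LHS](psd_subl hqs Dgs Dsg Dsv) [RHS](psd_subl hi g2 gs2 v2).
    by have := hg v Dv; have := hgs v Dsv; rewrite (hagree Dg Dv); lra.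
  split.
    by move=> H; apply: gn; move: H; apply: filterS => x /= H0; lra.
  split; first by move: ggs; apply: filterS => x; rewrite subr_ge0.
  split; first by move: ggs; apply: filterS => x; rewrite subr_le0.
  by move=> H; apply: gn; move: H; apply: filterS => x /= H0; lra.
- exists 1; apply: aeW => x; rewrite ler_norml.
  by have := g01 x; have := gs01 x; lra.
Qed.

End Extension.

(** Domains are saturated under a.e. equality, so [D <> Ds] as sets of functions is inequality of
    domains in L^2. The last integral is extended-real because [w] is only known to be
    square-integrable. *)
Theorem mainTheorem3 (d : measure_display) (X : measurableType d) (R : realType)
  (m : {measure set X -> \bar R}) (hm : sigma_finite setT m)
  (D Ds : set (X -> R)) (Q Qs : (X -> R) -> (X -> R) -> R)
  (hQ : is_dirichlet_form m D Q) (hQs : is_dirichlet_form m Ds Qs)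
  (hsub : D `<=` Ds)
  (hagree : forall u v, D u -> D v -> Qs u v = Q u v)
  (hmax : forall f u us, L2fun m f -> aele m (fun=> 0) f ->
     resolvent m D Q f u -> resolvent m Ds Qs f us -> aele m u us) :
  ((D <> Ds) <-> exists u w, cond_ii m D Ds Qs u w) /\
  (D <> Ds ->
     (exists u w, cond_ii m D Ds Qs u w /\ ess_bounded m u) /\
     (forall u w, cond_ii m D Ds Qs u w -> ess_bounded m u ->
        (\int[m]_x (w x)%:E != 0)%E)).
Proof.
have Hex := domain_neq_Lprime_nonpos hQ hQs hsub hagree hmax.
split; first split.
- by move=> /Hex[u [w [huw _]]]; exists u, w.
- by move=> [u [w huw]]; exact: Lprime_nonpos_domain_neq hQ hQs hsub _ _ huw.
- move=> DDs; split; first exact: Hex.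
  move=> u w [_ [[_ [[mw _] _]] [_ [_ [w0 wn0]]]]] _.
  exact: ae_le0_integral_neq0.
Qed.
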